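(* Let $k=\mathbb{Z}[y^2]$ and let $m\ge 1$. The third homology of the chain complex $C_\bullet^m$ of the normalized Yang-Baxter operator $R_{(m)}$ is, as a $k$-module, $$H_3(C_\bullet^m)\cong k^{\oplus\left(\binom{m-1}{0}+\binom{m-1}{1}+\binom{m-1}{2}+\binom{m-1}{3}\right)}\oplus\left(\frac{k}{(1-y^2)}\right)^{\oplus\left(2\binom{m-1}{1}+8\binom{m-1}{2}+5\binom{m-1}{3}\right)}\oplus\left(\frac{k}{(1-y^4)}\right)^{\oplus\left(2\binom{m-1}{1}+2\binom{m-1}{2}\right)}$$ $$= k^{\frac{m(8-3m+m^2)}{6}}\oplus\left(k/(1-y^2)\right)^{\frac{(m^2-1)(5m-6)}{6}}\oplus\left(k/(1-y^4)\right)^{m(m-1)}.$$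
   Context: Here $k=\mathbb{Z}[y^2]$ is the polynomial ring over $\mathbb{Z}$ in the variable $y^2$, and $y^4=(y^2)^2$. For $m\ge 1$ let $X_{(m)}=\{v_1,\dots,v_m\}$ be ordered by $v_i<v_j$ iff $i<j$, and let $V_{(m)}=kX_{(m)}$ be the free $k$-module on $X_{(m)}$. Basis elements $a_1\otimes\cdots\otimes a_n$ of $V_{(m)}^{\otimes n}$ (with $a_i\in X_{(m)}$) are written as tuples $(a_1,\dots,a_n)$. The normalized Yang-Baxter operator (yielding the HOMFLYPT polynomial) $R_{(m)}:V_{(m)}\otimes V_{(m)}\to V_{(m)}\otimes V_{(m)}$ is the $k$-linear map with $R_{(m)}(a,b)=(b,a)$ if $a\ge b$, and $R_{(m)}(a,b)=(1-y^2)(a,b)+y^2(b,a)$ if $a<b$. Chain complex $C_\bullet^m$: $C_n^m=V_{(m)}^{\otimes n}$ for $n\ge 0$ ($C_0^m=k$). For $1\le i\le n$, $d_i^{\ell}:C_n^m\to C_{n-1}^m$ applies $R_{(m)}$ to tensor positions $(i-1,i)$, then $(i-2,i-1)$, ..., then $(1,2)$, and then deletes the first tensor factor of each basis tuple; $d_i^{r}:C_n^m\to C_{n-1}^m$ applies $R_{(m)}$ to positions $(i,i+1)$, then $(i+1,i+2)$, ..., then $(n-1,n)$, and then deletes the last tensor factor of each basis tuple. The differential is $\partial_n=\sum_{i=1}^n(-1)^i(d_i^{\ell}-d_i^{r})$, and $H_n(R_{(m)})=H_n(C_\bullet^m)=\ker\partial_n/\operatorname{im}\partial_{n+1}$. 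*)

(* Defs.v *)
From HB Require Import structures.
From mathcomp Require Import all_boot all_order all_algebra.
From mathcomp Require Import boolp.

Set Implicit Arguments.
Unset Strict Implicit.
Unset Printing Implicit Defensive.

Import GRing.Theory.

Local Open Scope ring_scope.
Local Open Scope quotient_scope.

(* MathComp has no quotient of a left module by a submodule; it is built here
   as the Z-module quotient with the induced scaling. *)
Section LmoduleQuotient.
Variables (R : pzRingType) (V : lmodType R) (W : submodClosed V).

Definition submod_pred (v : V) : bool := v \in W.

Fact submod_pred_zmod_closed : zmod_closed submod_pred.
Proof.
split=> [|x y]; rewrite -!topredE /= /submod_pred; first exact: rpred0.
by move=> Wx Wy; rewrite rpredD // -scaleN1r rpredZ.
Qed.

HB.instance Definition _ :=
  GRing.isZmodClosed.Build V submod_pred submod_pred_zmod_closed.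

Definition lquot := Quotient.quot (GRing.ZmodClosed.clone V submod_pred _).

HB.instance Definition _ := Choice.on lquot.
HB.instance Definition _ := EqQuotient.on lquot.
HB.instance Definition _ := GRing.Zmodule.on lquot.
HB.instance Definition _ := ZmodQuotient.on lquot.

Definition lquot_pi (v : V) : lquot := \pi v.

Lemma lquot_piK : cancel repr lquot_pi.
Proof. exact: reprK. Qed.

Lemma eq_lquot (x y : V) : (lquot_pi x == lquot_pi y) = (x - y \in W).
Proof. by rewrite -Quotient.idealrBE. Qed.

Lemma lquot_piD : {morph lquot_pi : x y / x + y}.
Proof. by move=> x y; rewrite /lquot_pi raddfD. Qed.

Definition lquot_scale (a : R) (x : lquot) : lquot := lquot_pi (a *: repr x).

Lemma lquot_scale_pi (a : R) (v : V) :
  lquot_scale a (lquot_pi v) = lquot_pi (a *: v).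
Proof.
apply/eqP; rewrite eq_lquot -scalerBr; apply: rpredZ.
by rewrite -eq_lquot lquot_piK.
Qed.

Fact lquot_scalerA a b (x : lquot) :
  lquot_scale a (lquot_scale b x) = lquot_scale (a * b) x.
Proof. by rewrite -[x]lquot_piK !lquot_scale_pi scalerA. Qed.

Fact lquot_scale1r : left_id 1 lquot_scale.
Proof. by move=> x; rewrite -[x]lquot_piK lquot_scale_pi scale1r. Qed.

Fact lquot_scalerDr : right_distributive lquot_scale +%R.
Proof.
move=> a x y; rewrite -[x]lquot_piK -[y]lquot_piK -lquot_piD !lquot_scale_pi -lquot_piD.
by rewrite scalerDr.
Qed.

Fact lquot_scalerDl (x : lquot) : {morph lquot_scale^~ x : a b / a + b}.
Proof.
by move=> a b /=; rewrite -[x]lquot_piK !lquot_scale_pi -lquot_piD scalerDl.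
Qed.

HB.instance Definition _ := GRing.Zmodule_isLmodule.Build R lquot
  lquot_scalerA lquot_scale1r lquot_scalerDr lquot_scalerDl.

End LmoduleQuotient.

Definition lmod_iso (R : pzRingType) (U V : lmodType R) : Prop :=
  exists f : {linear U -> V}, bijective f.

(* ker g / im f for U --f--> V --g--> W. The submodule divided out consists of
   the elements of ker g lying in im f, which is im f itself if g \o f = 0. *)
Section Homology.
Variables (R : pzRingType) (U V W : lmodType R).
Variables (f : {linear U -> V}) (g : {linear V -> W}).

Definition in_ker (v : V) : bool := g v == 0.

Fact in_ker_submod : subsemimod_closed in_ker.
Proof.
split; first split=> [|x y]; rewrite ?unfold_in /in_ker ?linear0 //.
  by rewrite linearD => /eqP-> /eqP->; rewrite addr0.
by move=> a x; rewrite !unfold_in /in_ker linearZ /= => /eqP->; rewrite scaler0.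
Qed.

HB.instance Definition _ := GRing.isSubmodClosed.Build R V in_ker in_ker_submod.

Record cycles := Cycle { cycle_val : V; cycleP : in_ker cycle_val }.

HB.instance Definition _ := [isSub for cycle_val].
HB.instance Definition _ := [Choice of cycles by <:].
HB.instance Definition _ := [SubChoice_isSubZmodule of cycles by <:].
HB.instance Definition _ := [SubZmodule_isSubLmodule of cycles by <:].

Definition boundaries (z : cycles) : bool := `[< exists u, f u = \val z >].

Fact boundaries_submod : subsemimod_closed boundaries.
Proof.
split; first split=> [|x y]; rewrite ?unfold_in.
- by apply/asboolP; exists 0; rewrite !linear0.
- move=> /asboolP[u fu] /asboolP[v fv].
  by apply/asboolP; exists (u + v); rewrite linearD fu fv.
move=> a x; rewrite !unfold_in => /asboolP[u fu].
by apply/asboolP; exists (a *: u); rewrite linearZ fu.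
Qed.

HB.instance Definition _ :=
  GRing.isSubmodClosed.Build R cycles boundaries boundaries_submod.

Definition homology : lmodType R := lquot (GRing.SubmodClosed.clone R cycles boundaries _).

End Homology.

(* The cyclic module R / (p), over a commutative ring R. *)
Section CyclicModule.
Variables (R : comPzRingType) (p : R).

Definition in_principal (a : R^o) : bool := `[< exists b : R, a = b * p >].

Fact in_principal_submod : subsemimod_closed in_principal.
Proof.
split; first split=> [|x y]; rewrite ?unfold_in.
- by apply/asboolP; exists 0; rewrite mul0r.
- move=> /asboolP[u ->] /asboolP[v ->].
  by apply/asboolP; exists (u + v); rewrite mulrDl.
move=> a x; rewrite !unfold_in => /asboolP[u ->].
by apply/asboolP; exists (a * u); rewrite -mulrA.
Qed.

HB.instance Definition _ :=
  GRing.isSubmodClosed.Build R R^o in_principal in_principal_submod.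

Definition cyclic_mod : lmodType R := lquot (GRing.SubmodClosed.clone R R^o in_principal _).

End CyclicModule.

(* The free module on a finite set T, realized as the functions T -> R. *)
Section FreeModule.
Variables (R : comNzRingType) (T : finType).

Definition free_mod : lmodType R := {ffun T -> R^o}.

Definition basis (t : T) : free_mod := [ffun s => (s == t)%:R].

Definition linext (V : lmodType R) (f : T -> V) (c : free_mod) : V :=
  \sum_t (c t : R) *: f t.

Fact linext_is_linear (V : lmodType R) (f : T -> V) : linear (linext f).
Proof.
move=> a c d; rewrite /linext scaler_sumr -big_split /=.
by apply: eq_bigr => t _; rewrite !ffunE scalerDl scalerA.
Qed.

HB.instance Definition _ (V : lmodType R) (f : T -> V) :=
  GRing.isLinear.Build R free_mod V _ (linext f) (linext_is_linear f).

End FreeModule.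

(* The ring Z[y^2]; its indeterminate is y^2. *)
Definition kring : comNzRingType := {poly int}.
Definition y2 : kring := 'X.

Section YangBaxter.
Variable m : nat.

(* V^{(x) n} is the free module on the n-tuples of basis elements; the ordered
   basis v_1 < ... < v_m of V is 'I_m. *)
Definition chain (n : nat) : lmodType kring := free_mod kring (n.-tuple 'I_m).

Definition YB_basis (p : 'I_m * 'I_m) : free_mod kring ('I_m * 'I_m)%type :=
  let: (a, b) := p in
  if (b <= a)%N then basis kring (b, a)
  else (1 - y2) *: basis kring (a, b) + y2 *: basis kring (b, a).

Definition YB : free_mod kring ('I_m * 'I_m)%type ->
                free_mod kring ('I_m * 'I_m)%type :=
  linext YB_basis.

Definition replace2 n (i : 'I_n) (t : n.+1.-tuple 'I_m) (p : 'I_m * 'I_m)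
    : n.+1.-tuple 'I_m :=
  [tuple if j == i :> nat then p.1
         else if j == i.+1 :> nat then p.2 else tnth t j | j < n.+1].

(* id (x) R (x) id, with R in the positions (i, i + 1), counted from 0. *)
Definition YB_at n (i : 'I_n) : chain n.+1 -> chain n.+1 :=
  linext (fun t =>
    linext (fun p => basis kring (replace2 i t p))
      (YB (basis kring (tnth t (widen_ord (leqnSn n) i),
                        tnth t (lift ord0 i))))).

Definition delete n (q : 'I_n.+1) : chain n.+1 -> chain n :=
  linext (fun t => basis kring [tuple tnth t (lift q j) | j < n]).

(* Positions are counted from 0. The operators are applied in the order of the
   list, the head first: for dl the left positions are i - 1, ..., 1, 0, for dr
   they are i, i + 1, ..., n - 1. *)
Definition dl n (i : 'I_n.+1) (c : chain n.+1) : chain n :=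
  delete ord0
    (foldl (fun c j => YB_at j c) c [seq j : 'I_n <- rev (enum 'I_n) | (j < i)%N]).

Definition dr n (i : 'I_n.+1) (c : chain n.+1) : chain n :=
  delete ord_max
    (foldl (fun c j => YB_at j c) c [seq j : 'I_n <- enum 'I_n | (i <= j)%N]).

(* The differential out of degree n; in degree 0 it is zero. The exponent is
   i.+1 because i is counted from 0. *)
Definition diff (n : nat) : chain n -> chain n.-1 :=
  match n with
  | 0 => fun=> 0
  | n'.+1 => fun c => \sum_(i < n'.+1) (-1) ^+ i.+1 *: (dl i c - dr i c)
  end.

Lemma YB_foldl_linear n (s : seq 'I_n) :
  linear (fun c : chain n.+1 => foldl (fun c j => YB_at j c) c s).
Proof.
by move=> a c d; elim: s c d => //= j s IH c d; rewrite /YB_at linearP IH.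
Qed.

Fact diff_is_linear n : linear (@diff n).
Proof.
case: n => [|n] a c d /=; first by rewrite scaler0 addr0.
rewrite scaler_sumr -big_split; apply: eq_bigr => i _ /=.
rewrite /dl /dr !YB_foldl_linear /delete !linearP.
rewrite [a *: (_ *: _)]scalerA [a * _]mulrC -scalerA -scalerDr.
by rewrite addrACA -scalerDr.
Qed.

HB.instance Definition _ n :=
  GRing.isLinear.Build kring (chain n) (chain n.-1) _ (@diff n)
    (@diff_is_linear n).

Definition YB_homology (n : nat) : lmodType kring :=
  homology (@diff n.+1 : {linear chain n.+1 -> chain n})
           (@diff n : {linear chain n -> chain n.-1}).

End YangBaxter.

(* k^a (+) (k / (1 - y^2))^b (+) (k / (1 - y^4))^c *)
Definition sum_mod (a b c : nat) : lmodType kring :=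
  ({ffun 'I_a -> kring^o} * {ffun 'I_b -> cyclic_mod (1 - y2)}
   * {ffun 'I_c -> cyclic_mod (1 - y2 ^+ 2)})%type.

(* Main.v *)
Require Import Defs.
From HB Require Import structures.
From mathcomp Require Import all_boot all_order all_algebra.
From mathcomp Require Import boolp.
From mathcomp Require Import ring zify.

Set Implicit Arguments.
Unset Strict Implicit.
Unset Printing Implicit Defensive.

Import GRing.Theory.
Local Open Scope ring_scope.

(** Write x for y^2, and call the basis tuples of chains words in the letters
    0 < 1 < ... < m - 1.

    The operator R only compares letters, so the complex is functorial in the
    ordered alphabet: an order embedding that fixes 0, applied letter by letter,
    is a chain map. Call a map on words natural if it commutes with these
    embeddings. A word is determined by the set of its positive letters and by
    its pattern, obtained by renumbering the positive letters 1, ..., j in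
    increasing order; so a natural map is determined by its values on patterns.
    There are 6, 26 and 150 patterns of length 2, 3 and 4, for every m, and an
    identity between composites of natural maps holds for all m as soon as it
    holds on these patterns. The differential is natural (natural_diff_word,
    diff_basis).

    The homology in degree 3 is read off natural maps Z, P on 3-chains and
    W, h, g between chains of degrees 3 -> 4, 2 -> 3, 4 -> 3, together with a
    natural function p from 3-words to {0, 1 - x, 1 - x^2, 1}, such that
      - d3 Z = 0, and P Z is the identity on the words with p(w) <> 1,
      - (1 - x^2) (1 - Z P) = h d3, so that Z P is the identity on cycles,
      - d4 W = Z p and P d4 = p g.
    Thus the vectors Z w with p(w) <> 1 are a basis of the cycles, with
    coordinates P, and the boundaries are spanned by the p(w) Z w: the homology
    is the product of the k / (p(w)) over all 3-words w (diagonal_homology). As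
    p(w) depends on the pattern only, and a pattern with j positive letters is
    the pattern of 'C(m - 1, j) words (card_std), the three multiplicities
    follow by sorting the 26 patterns by the value of p.

    The reason why such maps exist is the following. Weakly increasing maps of
    alphabets are chain maps as well, because R(c, c) = (c, c) whether it is
    computed as a swap or as (1 - x) + x times the identity; so the complexes
    for varying m form a cosimplicial object, and the Dold-Kan normalisation
    splits each of them into pieces indexed by the sets T of positive letters. A
    basis of the piece of T is given by the alternating sums of the words
    obtained from a word w with positive letters T by lowering the letters of a
    subset of T to their predecessors in T with 0 added (normalize below); in
    this basis the differential of w is the old one with all words of a smaller
    letter set dropped. The differential is divisible by 1 - x, because R is the
    flip at x = 1 and the left and right faces then agree. Divided by 1 - x, the
    differential out of degree 4 can be brought to diagonal form on each piece
    by row and column operations with unit pivots and a last round of pivots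
    1 + x. The tables below record the result. *)

(** * Formal combinations of words *)

(** Combinations of words over Z[x] are stored as lists, with polynomials as
    lists of coefficients, constant term first, so that identities between them
    can be decided by evaluation. *)
Definition coef := seq int.
Definition word := seq nat.
Definition comb := seq (coef * word).
Definition table := seq (word * comb).

Definition term (p : coef) (w : word) : coef * word := (p, w).
Arguments term p%_R w%_N.

Definition unit_comb (w : word) : comb := [:: term [:: 1] w].

Fixpoint cadd (p q : coef) : coef :=
  match p, q with
  | [::], _ => q
  | _, [::] => p
  | a :: p', b :: q' => (a + b) :: cadd p' q'
  end.

Fixpoint cmul (p q : coef) : coef :=
  if p is a :: p' then cadd [seq a * b | b <- q] (0 :: cmul p' q) else [::].

(** The power series p / (1 - s x); [r] is the coefficient produced last. *)
Fixpoint cdiv (s r : int) (p : coef) : coef :=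
  if p is a :: p' then (a + s * r) :: cdiv s (a + s * r) p' else [::].

Definition czero (p : coef) := all (fun a => a == 0) p.

Definition scale (p : coef) (l : comb) : comb := [seq (cmul p a.1, a.2) | a <- l].

Definition bind (l : comb) (F : word -> comb) : comb :=
  flatten [seq scale a.1 (F a.2) | a <- l].

Fixpoint insert (a : coef * word) (l : comb) : comb :=
  if l is b :: l' then
    if b.2 == a.2 then (cadd a.1 b.1, b.2) :: l' else b :: insert a l'
  else [:: a].

Definition collect (l : comb) : comb :=
  [seq a <- foldr insert [::] l | ~~ czero a.1].

Definition sub (l1 l2 : comb) : comb := l1 ++ scale [:: -1] l2.

Definition rmap (f : nat -> nat) (l : comb) : comb := [seq (a.1, map f a.2) | a <- l].

Definition vanish (l : comb) : bool := collect l == [::].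

Definition ceval (p : coef) : kring := Poly p.
Arguments ceval : simpl never.

Lemma ceval_nil : ceval [::] = 0.
Proof. by []. Qed.

Lemma ceval_cons a p : ceval (a :: p) = ceval p * 'X + a%:P.
Proof. by rewrite /ceval /= cons_poly_def. Qed.

Lemma ceval_add p q : ceval (cadd p q) = ceval p + ceval q.
Proof.
elim: p q => [|a p IH] [|b q] /=; rewrite ?ceval_nil ?add0r ?addr0 //.
by rewrite !ceval_cons IH polyCD mulrDl addrACA.
Qed.

Lemma ceval_map a q : ceval [seq a * b | b <- q] = a%:P * ceval q.
Proof.
elim: q => [|b q IH] /=; first by rewrite ceval_nil mulr0.
by rewrite !ceval_cons IH polyCM mulrDr mulrA.
Qed.

Lemma ceval_mul p q : ceval (cmul p q) = ceval p * ceval q.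
Proof.
elim: p => [|a p IH] /=; first by rewrite ceval_nil mul0r.
rewrite ceval_add ceval_map ceval_cons IH polyC0 addr0 ceval_cons addrC.
by rewrite mulrDl mulrAC.
Qed.

Lemma ceval_zero p : czero p -> ceval p = 0.
Proof.
elim: p => [|a p IH] //= /andP[/eqP-> /IH p0].
by rewrite ceval_cons p0 mul0r polyC0 addr0.
Qed.

(** An identity decided on combinations holds in every module in which words
    are interpreted; G is such an interpretation. *)
Section Total.
Variables (V : lmodType kring) (G : word -> V).

Definition total (l : comb) : V := \sum_(a <- l) ceval a.1 *: G a.2.

Lemma total_cat l1 l2 : total (l1 ++ l2) = total l1 + total l2.
Proof. by rewrite /total big_cat. Qed.

Lemma total_scale p l : total (scale p l) = ceval p *: total l.
Proof.
rewrite /total big_map scaler_sumr; apply: eq_bigr => a _ /=.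
by rewrite ceval_mul scalerA.
Qed.

Lemma total_sub l1 l2 : total (sub l1 l2) = total l1 - total l2.
Proof.
rewrite total_cat total_scale ceval_cons ceval_nil mul0r add0r.
by rewrite polyCN scaleN1r.
Qed.

Lemma total_flatten ls : total (flatten ls) = \sum_(l <- ls) total l.
Proof.
elim: ls => [|l ls IH] /=; first by rewrite /total !big_nil.
by rewrite total_cat big_cons IH.
Qed.

Lemma total_unit w : total (unit_comb w) = G w.
Proof.
by rewrite /total big_seq1 /= ceval_cons ceval_nil mul0r add0r scale1r.
Qed.

Lemma total_insert a l : total (insert a l) = ceval a.1 *: G a.2 + total l.
Proof.
elim: l => [|b l IH] /=; first by rewrite /total big_seq1 big_nil addr0.
case: eqP => [eq_ba|_]; rewrite /total !big_cons /=.
  by rewrite ceval_add scalerDl eq_ba addrA.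
by rewrite -/(total _) IH addrCA.
Qed.

Lemma total_collect l : total (collect l) = total l.
Proof.
rewrite /collect; transitivity (total (foldr insert [::] l)); last first.
  by elim: l => [|a l IH] //=; rewrite total_insert IH /total big_cons.
rewrite /total big_filter [RHS](bigID (fun a => czero a.1)) /=.
rewrite [X in _ = X + _]big1 ?add0r //.
by move=> a /ceval_zero->; rewrite scale0r.
Qed.

Lemma vanish_total l : vanish l -> total l = 0.
Proof. by move=> /eqP l0; rewrite -total_collect l0 /total big_nil. Qed.

End Total.

Lemma total_bind (V : lmodType kring) (G : word -> V) l F :
  total G (bind l F) = total (fun w => total G (F w)) l.
Proof.
rewrite /bind total_flatten big_map; apply: eq_bigr => a _.
by rewrite total_scale.
Qed.

Lemma total_rmap (V : lmodType kring) (G : word -> V) f l :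
  total G (rmap f l) = total (fun w => G (map f w)) l.
Proof. by rewrite /total big_map. Qed.

(** * Order embeddings of the alphabet *)

(** The order embedding of {0, ..., size s} with values 0, s_1, s_2, ...; it
    continues strictly increasing beyond the end of s, which makes it an
    embedding of all of nat and spares bounds on the letters. *)
Definition relabel (s : seq nat) (i : nat) : nat := nth (last 0%N s + i)%N (0%N :: s) i.

(** The letter 0 is left out because embeddings fix it. *)
Definition letters (w : word) : seq nat := sort leq (undup [seq a <- w | (0 < a)%N]).

(** The pattern of a word. *)
Definition std (w : word) : word := [seq index a (0%N :: letters w) | a <- w].

Definition embedding (f : nat -> nat) :=
  {homo f : i j / (i < j)%N} /\ f 0%N = 0%N.

Definition natural (F : word -> comb) :=
  forall f w, embedding f -> F (map f w) = rmap f (F w).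

Lemma embedding_inj f : embedding f -> injective f.
Proof.
move=> [f_mono _] i j; case: (ltngtP i j) => // /f_mono.
  by move=> lt_f eq_f; rewrite eq_f ltnn in lt_f.
by move=> lt_f eq_f; rewrite eq_f ltnn in lt_f.
Qed.

Lemma embedding_leq f : embedding f -> {mono f : i j / (i <= j)%N}.
Proof. by move=> [f_mono _]; apply: leq_mono. Qed.

Lemma mem_letters w a : (a \in letters w) = (0 < a)%N && (a \in w).
Proof. by rewrite mem_sort mem_undup mem_filter. Qed.

Lemma letters_sorted w : sorted ltn (0%N :: letters w).
Proof.
rewrite /= path_sortedE; last exact: ltn_trans.
apply/andP; split; first by apply/allP => a; rewrite mem_letters => /andP[].
by rewrite ltn_sorted_uniq_leq sort_uniq undup_uniq sort_sorted //; apply: leq_total.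
Qed.

(** Both inequalities that cross the end of s compare with its last entry. *)
Lemma relabel_embedding s : sorted ltn (0%N :: s) -> embedding (relabel s).
Proof.
move=> s_sorted; split=> // i j lt_ij; rewrite /relabel.
have le_last k : (k <= size s)%N -> (nth 0 (0 :: s) k <= last 0 s)%N.
  rewrite -(nth_last 0%N) => le_k.
  have -> : nth 0%N s (size s).-1 = if s is [::] then 0%N else nth 0%N (0%N :: s) (size s).
    by case: (s).
  case: (s) s_sorted le_k => [|a s'] // s_sorted le_k; first by case: k le_k.
  have leq_s := sorted_leq_nth leq_trans leqnn 0%N.
  apply: leq_s; rewrite ?inE //.
  by apply: sub_sorted s_sorted => x y; apply: ltnW.
have [le_j|gt_j] := leqP j (size s).
  have le_i : (i <= size s)%N by apply: leq_trans le_j; apply: ltnW.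
  rewrite !(set_nth_default 0%N) //.
  apply: (sorted_ltn_nth ltn_trans 0%N s_sorted); rewrite ?inE //=.
rewrite [X in (_ < X)%N]nth_default //.
have [le_i|gt_i] := leqP i (size s).
  rewrite (set_nth_default 0%N) //.
  apply: leq_ltn_trans (le_last i le_i) _.
  by rewrite -{1}[last _ _]addn0 ltn_add2l (leq_ltn_trans _ lt_ij).
by rewrite nth_default // ltn_add2l.
Qed.

(** A word is recovered from its pattern and its letters: with naturality, this
    is what reduces statements about all words to statements about patterns. *)
Lemma relabel_std w : map (relabel (letters w)) (std w) = w.
Proof.
rewrite /std -map_comp -[RHS]map_id; apply/eq_in_map => a w_a.
change (relabel (letters w) (index a (0%N :: letters w)) = a).
have a_in : a \in 0%N :: letters w.
  by rewrite inE mem_letters w_a; case: (a).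
by rewrite /relabel (set_nth_default 0%N) ?index_mem // nth_index.
Qed.

Lemma size_std w : size (std w) = size w.
Proof. by rewrite size_map. Qed.

Lemma letters_map f w : embedding f -> letters (map f w) = map f (letters w).
Proof.
move=> f_emb; have [f_mono f0] := f_emb.
apply: (irr_sorted_eq ltn_trans ltnn).
- by have /= := letters_sorted (map f w); move/path_sorted.
- rewrite sorted_map; apply: sub_sorted (_ : sorted ltn (letters w)).
    by move=> i j /=; apply: f_mono.
  by have /= := letters_sorted w; move/path_sorted.
move=> a; rewrite mem_letters; apply/andP/mapP.
  case=> a_gt0 /mapP[b w_b def_a]; exists b => //.
  by rewrite mem_letters w_b lt0n andbT; apply: contraTneq a_gt0 => b0; rewrite def_a b0 f0.
case=> b; rewrite mem_letters => /andP[b_gt0 w_b] ->.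
by rewrite map_f // -[X in (X < _)%N]f0 f_mono.
Qed.

Lemma std_map f w : embedding f -> std (map f w) = std w.
Proof.
move=> f_emb; rewrite /std letters_map // -map_comp; apply/eq_map => a.
have -> : 0%N :: map f (letters w) = map f (0%N :: letters w).
  by rewrite /= (proj2 f_emb).
exact/index_map/embedding_inj.
Qed.

Lemma std_idem w : std (std w) = std w.
Proof.
by rewrite -{2}(relabel_std w) std_map //; apply/relabel_embedding/letters_sorted.
Qed.

Lemma size_letters_std w : size (letters (std w)) = size (letters w).
Proof.
rewrite -{2}(relabel_std w) letters_map ?size_map //.
exact/relabel_embedding/letters_sorted.
Qed.

Lemma std_bound w : all (leq^~ (size (letters w))) (std w).
Proof.
apply/allP => i /mapP[a w_a ->].
have : a \in 0%N :: letters w by rewrite inE mem_letters w_a; case: (a).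
by rewrite -index_mem ltnS.
Qed.

Lemma size_letters w : (size (letters w) <= size w)%N.
Proof.
rewrite size_sort; apply: leq_trans (size_undup _) _.
by rewrite size_filter count_size.
Qed.

Fixpoint all_words (k n : nat) : seq word :=
  if n is n'.+1 then [seq i :: w | i <- iota 0 k, w <- all_words k n'] else [:: [::]].

(** The letters of a pattern of length n are at most n, since 1, ..., j all
    occur in it. *)
Definition patterns (n : nat) : seq word := [seq w <- all_words n.+1 n | std w == w].

Lemma mem_all_words k n w :
  (w \in all_words k n) = (size w == n) && all (fun i => i < k)%N w.
Proof.
elim: n w => [|n IH] [|i w] //=; last first.
- rewrite eqSS andbCA -IH.
  apply/allpairsP/andP => [[[a v] /= [+ v_in [-> ->]]]|[lt_ik w_in]].
    by rewrite mem_iota.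
  by exists (i, w); rewrite mem_iota.
by apply/negbTE/allpairsP => -[[a v] /= []].
Qed.

Lemma std_pattern w : std w \in patterns (size w).
Proof.
rewrite mem_filter std_idem eqxx mem_all_words size_std eqxx /=.
apply: sub_all (std_bound w) => i le_i.
by rewrite ltnS (leq_trans le_i) ?size_letters.
Qed.

(** * The differential on words *)

Definition replace_at (i : nat) (w : word) (a b : nat) : word :=
  [seq if j == i then a else if j == i.+1 then b else nth 0%N w j
  | j <- iota 0 (size w)].

Definition YB_word (i : nat) (w : word) : comb :=
  let a := nth 0%N w i in
  let b := nth 0%N w i.+1 in
  if (b <= a)%N then unit_comb (replace_at i w b a)
  else [:: term [:: 1; -1] (replace_at i w a b); term [:: 0; 1] (replace_at i w b a)].

Definition delete_word (q : nat) (w : word) : word :=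
  [seq nth 0%N w (bump q j) | j <- iota 0 (size w).-1].

Definition braid (s : seq nat) (w : word) : comb :=
  foldl (fun l j => bind l (YB_word j)) (unit_comb w) s.

Definition face (q : nat) (s : seq nat) (w : word) : comb :=
  [seq (a.1, delete_word q a.2) | a <- braid s w].

(** Tensor factors are counted from 0, hence the exponent i + 1 of the sign. *)
Definition diff_word (w : word) : comb :=
  let n := (size w).-1 in
  flatten [seq scale [:: (-1) ^+ i.+1]
             (sub (face 0 [seq j <- rev (iota 0 n) | (j < i)%N] w)
                  (face n [seq j <- iota 0 n | (i <= j)%N] w))
          | i <- iota 0 (size w)].

Section Embed.
Variables (f : nat -> nat) (f_emb : embedding f).

Lemma nth_embed w i : nth 0%N (map f w) i = f (nth 0%N w i).
Proof.
have [lt_i|ge_i] := ltnP i (size w); first by rewrite (nth_map 0%N).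
by rewrite !nth_default ?size_map // (proj2 f_emb).
Qed.

Lemma replace_at_embed i w a b :
  replace_at i (map f w) (f a) (f b) = map f (replace_at i w a b).
Proof.
rewrite /replace_at size_map -map_comp; apply: eq_map => j /=.
by rewrite nth_embed; case: ifP => // _; case: ifP.
Qed.

Lemma delete_word_embed q w : delete_word q (map f w) = map f (delete_word q w).
Proof.
rewrite /delete_word size_map -map_comp; apply: eq_map => j /=.
exact: nth_embed.
Qed.

Lemma rmap_scale p l : rmap f (scale p l) = scale p (rmap f l).
Proof. by rewrite /rmap /scale -!map_comp. Qed.

Lemma rmap_sub l1 l2 : rmap f (sub l1 l2) = sub (rmap f l1) (rmap f l2).
Proof. by rewrite /rmap /sub map_cat -!/(rmap f _) rmap_scale. Qed.

Lemma rmap_flatten ls : rmap f (flatten ls) = flatten [seq rmap f l | l <- ls].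
Proof. exact: map_flatten. Qed.

Lemma rmap_bind l F : natural F -> rmap f (bind l F) = bind (rmap f l) F.
Proof.
move=> F_nat; rewrite /bind rmap_flatten -!map_comp; congr flatten.
by apply: eq_map => a /=; rewrite rmap_scale F_nat.
Qed.

End Embed.

(** The operator branches on a comparison of two letters, which an embedding
    preserves in both directions; everything else follows from this. *)
Lemma natural_YB_word i : natural (YB_word i).
Proof.
move=> f w f_emb; rewrite /YB_word !nth_embed // (embedding_leq f_emb).
by case: leqP => _; rewrite !replace_at_embed.
Qed.

Lemma braid_embed f s w : embedding f -> braid s (map f w) = rmap f (braid s w).
Proof.
move=> f_emb; rewrite /braid.
have -> : unit_comb (map f w) = rmap f (unit_comb w) by [].
elim: s (unit_comb w) => //= i s IH l.
by rewrite -IH (rmap_bind f_emb) //; apply: natural_YB_word.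
Qed.

Lemma face_embed q f s w : embedding f -> face q s (map f w) = rmap f (face q s w).
Proof.
move=> f_emb; rewrite /face braid_embed // /rmap -!map_comp; apply: eq_map => a /=.
by rewrite delete_word_embed.
Qed.

Lemma natural_diff_word : natural diff_word.
Proof.
move=> f w f_emb; rewrite /diff_word size_map rmap_flatten -map_comp.
congr flatten; apply: eq_map => i /=.
by rewrite rmap_scale rmap_sub !face_embed.
Qed.

(** * Natural maps given by tables *)

(** A word without a row is sent to 0. *)
Definition lookup (t : table) (w : word) : comb :=
  oapp snd [::] (ohead [seq r <- t | r.1 == w]).

(** The natural map with prescribed values on patterns. *)
Definition extend (t : table) (w : word) : comb :=
  rmap (relabel (letters w)) (lookup t (std w)).

Definition tabulate (n : nat) (F : word -> comb) : table :=
  [seq (w, collect (F w)) | w <- patterns n].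

(** The letters of the terms must come from those of w, together with 0: then
    a map can be computed inside any alphabet containing those of w, and its
    value on a pattern is transported to every word of that pattern. *)
Definition fits (b : nat) (w : word) (l : comb) : bool :=
  all (fun a => (size a.2 == b) && all (mem (0%N :: letters w)) a.2) l.

Definition table_fits (b : nat) (t : table) : bool :=
  all (fun r => fits b r.1 r.2) t.

Definition local_map (a b : nat) (F : word -> comb) : Prop :=
  natural F /\ forall w, size w = a -> fits b w (F w).

Lemma lookup_fits b t w : table_fits b t -> fits b w (lookup t w).
Proof.
move=> /allP t_fits; rewrite /lookup.
case def_rs: [seq r <- t | r.1 == w] => [|r rs] //=.
have : r \in [seq r <- t | r.1 == w] by rewrite def_rs mem_head.
by rewrite mem_filter => /andP[/eqP<- /t_fits].
Qed.

Lemma letters_std_bound w i :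
  i \in 0%N :: letters (std w) -> (i <= size (letters w))%N.
Proof.
rewrite inE mem_letters => /predU1P[->//|/andP[_]].
exact: (allP (std_bound w)).
Qed.

Lemma fits_relabel b w l :
  fits b (std w) l -> fits b w (rmap (relabel (letters w)) l).
Proof.
have emb := relabel_embedding (letters_sorted w).
rewrite /fits /rmap all_map; apply: sub_all => x /= /andP[/eqP<-].
rewrite size_map eqxx all_map; apply: sub_all => i /=.
rewrite !inE !mem_letters => /predU1P[->|/andP[i_gt0 i_in]]; first by rewrite eqxx.
rewrite -[X in (X < _)%N](proj2 emb) (proj1 emb) //=.
by rewrite -[X in _ \in X](relabel_std w) map_f ?orbT.
Qed.

Lemma relabel_map f s i : embedding f -> (i <= size s)%N ->
  relabel (map f s) i = f (relabel s i).
Proof.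
move=> f_emb le_i; rewrite /relabel.
have -> : 0%N :: map f s = map f (0%N :: s) by rewrite /= (proj2 f_emb).
by rewrite (nth_map (last 0 s + i)%N).
Qed.

(** A word and its image under an embedding share the pattern, hence the row of
    the table; the letters of that row lie in the range where relabelling
    commutes with the embedding. *)
Lemma extend_local a b t : table_fits b t -> local_map a b (extend t).
Proof.
move=> t_fits; split=> [f w f_emb|w _]; last exact/fits_relabel/lookup_fits.
rewrite /extend std_map // letters_map // /rmap -map_comp.
apply/eq_in_map => x /(allP (lookup_fits (std w) t_fits))/andP[_ /allP x_in] /=.
congr (_, _); rewrite -map_comp; apply/eq_in_map => i /x_in i_in /=.
by rewrite relabel_map // letters_std_bound.
Qed.

Lemma natural_local a b F :
    natural F -> all (fun w => fits b w (F w)) (patterns a) -> local_map a b F.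
Proof.
move=> F_nat /allP F_fits; split=> // w size_w.
have := F_fits (std w); rewrite -size_w std_pattern => /(_ isT)/fits_relabel.
by rewrite -F_nat ?relabel_std //; apply/relabel_embedding/letters_sorted.
Qed.

Lemma diff_word4_local : local_map 4 3 diff_word.
Proof. by apply: natural_local; [exact: natural_diff_word|vm_compute]. Qed.

Lemma diff_word3_local : local_map 3 2 diff_word.
Proof. by apply: natural_local; [exact: natural_diff_word|vm_compute]. Qed.

(** * Chains and words *)

Lemma ceval_1BX : ceval [:: 1; -1] = 1 - y2.
Proof.
by rewrite !ceval_cons ceval_nil mul0r add0r polyCN mulN1r addrC.
Qed.

Lemma ceval_X : ceval [:: 0; 1] = y2.
Proof. by rewrite !ceval_cons ceval_nil mul0r add0r polyC0 addr0 mul1r. Qed.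

Lemma ceval_sign i : ceval [:: (-1) ^+ i] = (-1) ^+ i.
Proof. by rewrite ceval_cons ceval_nil mul0r add0r rmorph_sign. Qed.

Section Chains.
Variable m : nat.

(** Words that are not n-tuples over the alphabet are sent to 0. *)
Definition wvec n (w : word) : chain m n := [ffun t : n.-tuple 'I_m => (map val t == w)%:R].

Definition valid n (w : word) := (size w == n) && all (fun i => i < m)%N w.

Lemma wvec_tuple n (t : n.-tuple 'I_m) : wvec n (map val t) = basis kring t.
Proof.
apply/ffunP => s; rewrite !ffunE; congr (nat_of_bool _)%:R.
by rewrite (inj_eq (inj_map val_inj)).
Qed.

Lemma validP n w : reflect (exists t : n.-tuple 'I_m, w = map val t) (valid n w).
Proof.
apply: (iffP andP) => [[/eqP size_w /allP lt_w]|[t ->]]; last first.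
  rewrite size_map size_tuple; split=> //.
  by apply/allP => _ /mapP[i _ ->]; apply: ltn_ord.
have [s def_w] : exists s : seq 'I_m, w = map val s.
  exists (pmap insub w); rewrite (pmap_filter (insubK _)).
  by apply/esym/all_filterP/allP => i /lt_w lt_i; rewrite /= isSome_insub.
have size_s : size s == n by rewrite -size_w def_w size_map.
by exists (Tuple size_s).
Qed.

Lemma linext_basis (T : finType) (V : lmodType kring) (f : T -> V) (t : T) :
  linext f (basis kring t) = f t.
Proof.
rewrite /linext (bigD1 t) //= ffunE eqxx scale1r big1 ?addr0 // => s ne_st.
by rewrite ffunE (negbTE ne_st) scale0r.
Qed.

Lemma chain_linear_ext (T : finType) (V : lmodType kring)
    (f g : free_mod kring T -> V) :
    linear f -> linear g -> (forall t, f (basis kring t) = g (basis kring t)) ->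
  f =1 g.
Proof.
move=> f_lin g_lin eq_fg c.
pose F : {linear free_mod kring T -> V} := HB.pack f (GRing.isLinear.Build _ _ _ _ f f_lin).
pose G : {linear free_mod kring T -> V} := HB.pack g (GRing.isLinear.Build _ _ _ _ g g_lin).
have -> : c = \sum_t (c t : kring) *: basis kring t.
  apply/ffunP => s; rewrite sum_ffunE (bigD1 s) //= big1 ?addr0 => [|t ne_ts].
    by rewrite !ffunE eqxx; apply/esym/mulr1.
  by rewrite !ffunE eq_sym (negbTE ne_ts); apply: mulr0.
rewrite -[f]/(F : _ -> _) -[g]/(G : _ -> _) !linear_sum; apply: eq_bigr => t _.
by rewrite !linearZ /= eq_fg.
Qed.

Lemma map_tuple_nth n (t : n.-tuple 'I_m) (i : 'I_n) :
  nth 0%N (map val t) i = tnth t i.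
Proof. by rewrite (nth_map (tnth_default t i)) ?size_tuple // -tnth_nth. Qed.

Lemma map_replace2 n (i : 'I_n) (t : n.+1.-tuple 'I_m) p :
  map val (replace2 i t p) = replace_at i (map val t) (val p.1) (val p.2).
Proof.
have size_t : size (map val t) = n.+1 by rewrite size_map size_tuple.
have size_l : size (map val (replace2 i t p)) = n.+1 by rewrite size_map size_tuple.
apply: (@eq_from_nth _ 0%N) => [|j]; rewrite size_l ?[RHS]size_map ?size_iota //.
move=> lt_j.
rewrite -[j]/(val (Ordinal lt_j)) map_tuple_nth tnth_mktuple.
rewrite (nth_map 0%N) ?size_iota ?size_t // nth_iota ?size_t // add0n.
rewrite -[j in RHS]/(val (Ordinal lt_j)) map_tuple_nth /=.
by case: ifP => // _; case: ifP.
Qed.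

Lemma YB_at_basis n (i : 'I_n) (t : n.+1.-tuple 'I_m) :
  YB_at i (basis kring t) = total (wvec n.+1) (YB_word i (map val t)).
Proof.
rewrite /YB_at linext_basis /YB linext_basis /YB_word /=.
rewrite -[i : nat]/(val (widen_ord (leqnSn n) i)) map_tuple_nth.
rewrite -[i.+1]/(val (lift ord0 i)) map_tuple_nth /=.
set a := tnth t _; set b := tnth t _.
case: ifP => le_ba.
  by rewrite linext_basis total_unit -wvec_tuple map_replace2.
rewrite linearD !linearZ /= !linext_basis.
rewrite /total big_cons big_seq1 /= -!wvec_tuple !map_replace2 /=.
by rewrite ceval_1BX ceval_X.
Qed.

Lemma valid_replace_at n i w a b :
  valid n w -> (a < m)%N -> (b < m)%N -> valid n (replace_at i w a b).
Proof.
move=> /andP[/eqP size_w /allP lt_w] lt_a lt_b.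
rewrite /valid size_map size_iota size_w eqxx; apply/allP => _ /mapP[j + ->].
rewrite mem_iota /= => lt_j; case: ifP => // _; case: ifP => // _.
by rewrite lt_w ?mem_nth.
Qed.

Lemma valid_YB_word n i w : (i < n)%N ->
  valid n.+1 w -> all (fun a => valid n.+1 a.2) (YB_word i w).
Proof.
move=> lt_i w_val; have /andP[/eqP size_w /allP lt_w] := w_val.
have lt_nth j : (j <= n)%N -> (nth 0 w j < m)%N.
  by move=> le_j; rewrite lt_w ?mem_nth // size_w.
rewrite /YB_word; case: ifP => _ /=;
  by rewrite !valid_replace_at ?lt_nth // ltnW.
Qed.

Lemma all_bind (Q : pred word) l (F : word -> comb) :
  {in [seq a.2 | a <- l], forall w, all (fun a => Q a.2) (F w)} ->
  all (fun a => Q a.2) (bind l F).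
Proof.
move=> F_Q; apply/allP => x /flatten_mapP[a l_a /mapP[b F_b ->]] /=.
exact: (allP (F_Q a.2 (map_f _ l_a))).
Qed.

(** Validity is carried along because wvec loses the invalid words, on which
    YB_word need not vanish. *)
Lemma foldl_YB n (s : seq 'I_n) l : all (fun a => valid n.+1 a.2) l ->
  foldl (fun c j => YB_at j c) (total (wvec n.+1) l) s =
    total (wvec n.+1) (foldl (fun l j => bind l (YB_word j)) l (map val s))
  /\ all (fun a => valid n.+1 a.2)
       (foldl (fun l j => bind l (YB_word j)) l (map val s)).
Proof.
elim: s l => //= i s IH l /allP l_val.
have -> : YB_at i (total (wvec n.+1) l) = total (wvec n.+1) (bind l (YB_word i)).
  rewrite total_bind /total /YB_at linear_sum big_seq [RHS]big_seq.
  apply: eq_bigr => a /l_val /= /validP[t def_a].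
  rewrite linearZ /=; congr (_ *: _).
  by rewrite def_a wvec_tuple; apply: YB_at_basis.
apply: IH; apply: all_bind => w /mapP[a l_a ->].
by apply: valid_YB_word; [exact: ltn_ord|exact: l_val].
Qed.

Lemma delete_basis n (q : 'I_n.+1) w : valid n.+1 w ->
  delete q (wvec n.+1 w) = wvec n (delete_word q w).
Proof.
move=> /validP[t ->]; rewrite wvec_tuple /delete linext_basis -wvec_tuple.
congr wvec; rewrite /delete_word size_map size_tuple -[n.+1.-1]/n.
have size_l : size (map val [tuple tnth t (lift q j) | j < n]) = n.
  by rewrite size_map size_tuple.
apply: (@eq_from_nth _ 0%N) => [|j]; rewrite size_l ?size_map ?size_iota // => lt_j.
rewrite (nth_map 0%N) ?size_iota // nth_iota // add0n.
rewrite -[j in LHS]/(val (Ordinal lt_j)) map_tuple_nth tnth_mktuple.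
by rewrite -[bump q j]/(val (lift q (Ordinal lt_j))) map_tuple_nth.
Qed.

Lemma face_basis n (q : 'I_n.+1) (s : seq 'I_n) (t : n.+1.-tuple 'I_m) :
  delete q (foldl (fun c j => YB_at j c) (basis kring t) s) =
  total (wvec n) (face q (map val s) (map val t)).
Proof.
have t_val : all (fun a => valid n.+1 a.2) (unit_comb (map val t)).
  by rewrite /= andbT; apply/validP; exists t.
have [] := foldl_YB s t_val; rewrite total_unit wvec_tuple => -> /allP l_val.
rewrite /total /face big_map /delete linear_sum big_seq [RHS]big_seq.
apply: eq_bigr => a /l_val a_val; rewrite linearZ /=; congr (_ *: _).
exact: delete_basis.
Qed.

Lemma diff_basis n (t : n.+1.-tuple 'I_m) :
  diff (basis kring t) = total (wvec n) (diff_word (map val t)).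
Proof.
rewrite /diff_word total_flatten big_map size_map size_tuple.
rewrite -[n.+1.-1]/n -[iota 0 n.+1]/(index_iota 0 n.+1) big_mkord; apply: eq_bigr => i _.
rewrite total_scale total_sub ceval_sign /dl /dr !face_basis.
congr (_ *: (total _ (face _ _ _) - total _ (face _ _ _))).
  by rewrite -val_enum_ord -map_rev filter_map.
by rewrite -val_enum_ord filter_map.
Qed.
End Chains.

Section Action.
Variables (m : nat) (m_gt0 : (0 < m)%N).

Definition act a b (F : word -> comb) : chain m a -> chain m b :=
  linext (fun t : a.-tuple 'I_m => total (wvec m b) (F (map val t))).

HB.instance Definition _ a b F := GRing.Linear.on (@act a b F).

(** A combination of words in the letters of the pattern of w, carried over to
    the letters of w. *)
Definition push n (w : word) (l : comb) : chain m n :=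
  total (fun u => wvec m n (map (relabel (letters w)) u)) l.

Lemma push_unit n (t : n.-tuple 'I_m) :
  push n (map val t) (unit_comb (std (map val t))) = basis kring t.
Proof. by rewrite /push total_unit relabel_std wvec_tuple. Qed.

Lemma natural_std F w : natural F -> F w = rmap (relabel (letters w)) (F (std w)).
Proof.
move=> F_nat; rewrite -F_nat ?relabel_std //.
exact/relabel_embedding/letters_sorted.
Qed.

Lemma act_basis a b F (t : a.-tuple 'I_m) : natural F ->
  act b F (basis kring t) = push b (map val t) (F (std (map val t))).
Proof.
by move=> F_nat; rewrite /act linext_basis (natural_std _ F_nat) total_rmap.
Qed.

(** The words of the relabelled combination are tuples over the alphabet, by the
    condition on letters in fits, so that F applies to each of them. *)
Lemma act_push a b F n (t : n.-tuple 'I_m) l :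
    natural F -> fits a (std (map val t)) l ->
  act b F (push a (map val t) l) = push b (map val t) (bind l F).
Proof.
move=> F_nat /fits_relabel; set w : word := map val t => l_fits.
have emb := relabel_embedding (letters_sorted w).
rewrite /push total_bind /total linear_sum big_seq [RHS]big_seq.
apply: eq_bigr => x l_x; rewrite linearZ; congr (_ *: _).
have /(allP l_fits)/andP[/= size_x /allP in_x] :=
  map_f (fun x => (x.1, map (relabel (letters w)) x.2)) l_x.
have /validP[s def_s] : valid m a (map (relabel (letters w)) x.2).
  rewrite /valid size_x; apply/allP => i /in_x /=.
  rewrite inE mem_letters => /predU1P[->//|/andP[_ /mapP[j _ ->]]].
  exact: ltn_ord.
rewrite def_s wvec_tuple /act linext_basis -def_s F_nat //.
exact: (total_rmap (wvec m b)).
Qed.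

Lemma linear_eq0 (T : finType) (V : lmodType kring)
    (F : {linear free_mod kring T -> V}) :
  (forall t, F (basis kring t) = 0) -> forall c, F c = 0.
Proof.
move=> F0 c; apply: (chain_linear_ext (g := fun=> 0)) => // [|a u v].
  exact: linearP.
by rewrite scaler0 addr0.
Qed.

(** The composite on any word is the transport of the composite on its pattern,
    so that an identity between such composites is a finite computation. *)
Lemma act_comp_basis a b c F G (t : a.-tuple 'I_m) :
    local_map a b F -> natural G ->
  act c G (act b F (basis kring t)) =
    push c (map val t) (bind (F (std (map val t))) G).
Proof.
move=> [F_nat F_fits] G_nat; rewrite act_basis // act_push //.
by apply: F_fits; rewrite size_std size_map size_tuple.
Qed.

Lemma diff_act n c : @diff m n.+1 c = act n diff_word c.
Proof.
by apply: chain_linear_ext c => [||t]; [exact: linearP|exact: linearP|];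
  rewrite diff_basis /act linext_basis.
Qed.

Lemma push_vanish n w l : vanish l -> push n w l = 0.
Proof. exact: vanish_total. Qed.

End Action.

(** * The homology of a diagonalised complex *)

(** The first isomorphism theorem for homology. *)
Section FirstIsomorphism.
Variables (R : pzRingType) (U V W X : lmodType R).
Variables (f : {linear U -> V}) (g : {linear V -> W}) (F : {linear V -> X}).
Hypothesis F_boundary : forall v, g v = 0 -> F v = 0 <-> exists u, f u = v.
Hypothesis F_onto : forall x, exists2 v, g v = 0 & F v = x.

Let B := GRing.SubmodClosed.clone R (cycles g) (boundaries f (g := g)) _.

Let induced (q : homology f g) : X := F (val (repr q : cycles g)).

Let cycle_eq0 (z : cycles g) : g (val z) = 0.
Proof. exact/eqP/(cycleP z). Qed.

Let F_valB (y z : cycles g) : F (val y) - F (val z) = F (val (y - z)).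
Proof. by rewrite -linearB. Qed.

Let induced_pi (z : cycles g) : induced (lquot_pi B z) = F (val z).
Proof.
apply/eqP; rewrite -subr_eq0 /induced F_valB; apply/eqP.
apply/F_boundary; first exact: cycle_eq0.
have : repr (lquot_pi B z : homology f g) - z \in B.
  by rewrite -eq_lquot lquot_piK.
by move=> /asboolP.
Qed.

Let induced_linear : linear induced.
Proof.
move=> a q r; rewrite -[q](lquot_piK (W := B)) -[r](lquot_piK (W := B)).
have -> : a *: lquot_pi B (repr q) + lquot_pi B (repr r) =
    lquot_pi B (a *: repr q + repr r).
  by rewrite lquot_piD -lquot_scale_pi.
by rewrite !induced_pi /= linearP.
Qed.

Let induced_inj : injective induced.
Proof.
move=> q r; rewrite -(lquot_piK (W := B) q) -(lquot_piK (W := B) r).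
rewrite !induced_pi => /eqP; rewrite -subr_eq0 F_valB => /eqP F0.
apply/eqP; rewrite eq_lquot; apply/asboolP.
by apply/F_boundary; first exact: cycle_eq0.
Qed.

Lemma homology_iso : lmod_iso (homology f g) X.
Proof.
pose phi : {linear homology f g -> X} :=
  HB.pack induced (GRing.isLinear.Build _ _ _ _ induced induced_linear).
exists phi; have lift x : {q : homology f g | phi q = x}.
  apply: cid; have [v gv0 <-] := F_onto x.
  have v_cycle : in_ker g v by apply/eqP.
  by exists (lquot_pi B (Cycle v_cycle)); apply: induced_pi.
exists (fun x => sval (lift x)) => [q|x]; last exact: svalP (lift x).
by apply: induced_inj; apply: (svalP (lift _)).
Qed.
End FirstIsomorphism.

Section CyclicQuotient.
Variable p : kring.

Definition residue (a : kring) : cyclic_mod p :=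
  lquot_pi (GRing.SubmodClosed.clone kring kring^o (in_principal p) _) a.

Lemma residue_linear (a x y : kring) :
  residue (a * x + y) = a *: residue x + residue y.
Proof. by rewrite /residue lquot_piD -lquot_scale_pi. Qed.

Lemma residue_eq0 a : residue a = 0 <-> exists b, a = b * p.
Proof.
have -> : (0 : cyclic_mod p) = residue 0.
  by have := residue_linear (-1) 0 0; rewrite mulr0 addr0 scaleN1r addNr.
split=> [/eqP|a_p]; first by rewrite eq_lquot subr0 => /asboolP.
by apply/eqP; rewrite eq_lquot subr0; apply/asboolP.
Qed.

Lemma residue_onto x : exists a, residue a = x.
Proof. by exists (repr x); apply: lquot_piK. Qed.
End CyclicQuotient.

(** Kinds 0, 1, 2 are the summands of sum_mod; from 3 on, the summand k / (1)
    vanishes. *)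
Definition elementary_divisor (k : nat) : kring :=
  match k with 0 => 0 | 1 => 1 - y2 | 2 => 1 - y2 ^+ 2 | _ => 1 end.

Section DiagonalHomology.
Variables (V4 V3 V2 : lmodType kring).
Variables (d4 : {linear V4 -> V3}) (d3 : {linear V3 -> V2}).
Variables (I : finType) (kind : I -> nat).
Let A := free_mod kring I.
Variables (Z : {linear A -> V3}) (P : {linear V3 -> A}) (W : {linear A -> V4}).
Variables (g : {linear V4 -> A}) (h : {linear V2 -> V3}) (q : kring).
Let p (i : I) := elementary_divisor (kind i).

(** The map h witnesses that Z P is the identity on cycles; the factor q allows
    the image of d3 not to be a direct summand. *)
Hypothesis d3Z : forall c, d3 (Z c) = 0.
Hypothesis PZ : forall (c : A) i, (kind i < 3)%N -> P (Z c) i = c i.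
Hypothesis ZPh : forall v, q *: (v - Z (P v)) = h (d3 v).
Hypothesis q_regular : forall v : V3, q *: v = 0 -> v = 0.
Hypothesis d4W : forall c : A, d4 (W c) = Z [ffun i => p i * c i].
Hypothesis Pd4 : forall u i, P (d4 u) i = p i * g u i.

Let K k := [pred i | kind i == k].
Let nth_of_kind k (j : 'I_#|K k|) : I := enum_val j.
Arguments nth_of_kind : clear implicits.

Let kind_index k (j : 'I_#|K k|) : kind (nth_of_kind k j) = k.
Proof. by apply/eqP; have := enum_valP j. Qed.

(** On cycles, this map induces the isomorphism. *)
Let coords (v : V3) : sum_mod #|K 0| #|K 1| #|K 2| :=
  ([ffun j => P v (nth_of_kind 0 j)], [ffun j => residue (1 - y2) (P v (nth_of_kind 1 j))],
   [ffun j => residue (1 - y2 ^+ 2) (P v (nth_of_kind 2 j))]).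

Let coords_linear : linear coords.
Proof.
move=> a v w; rewrite /coords linearP.
congr (_, _, _); apply/ffunP => j; rewrite !ffunE //; exact: residue_linear.
Qed.

Let coords_eq0 v :
  coords v = 0 <-> forall i, (kind i < 3)%N -> exists b, P v i = b * p i.
Proof.
split=> [[/ffunP v0 /ffunP v1 /ffunP v2] i lt_k|v_div].
  have i_in : i \in K (kind i) by rewrite inE.
  rewrite /p -(enum_rankK_in i_in i_in); set j := enum_rank_in _ _.
  move: j; case: (kind i) lt_k => [|[|[|//]]] _ j; rewrite -/(nth_of_kind _ j) kind_index.
  - by exists 0; have := v0 j; rewrite !ffunE mulr0.
  - by apply/residue_eq0; have := v1 j; rewrite !ffunE.
  - by apply/residue_eq0; have := v2 j; rewrite !ffunE.
congr (_, _, _); apply/ffunP => j; rewrite !ffunE.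
- by have [|b ->] := v_div (nth_of_kind 0 j); rewrite /p kind_index //= mulr0.
- by apply/residue_eq0; have := v_div (nth_of_kind 1 j); rewrite /p kind_index; apply.
- by apply/residue_eq0; have := v_div (nth_of_kind 2 j); rewrite /p kind_index; apply.
Qed.

Let coords_boundary v : d3 v = 0 -> coords v = 0 <-> exists u, d4 u = v.
Proof.
move=> d3v0; split=> [/coords_eq0 v_div|[u <-]]; last first.
  by apply/coords_eq0 => i _; exists (g u i); rewrite Pd4 mulrC.
have def_v : v = Z (P v).
  by apply/eqP; rewrite -subr_eq0; apply/eqP/q_regular; rewrite ZPh d3v0 linear0.
have div i : {b | P v i = b * p i}.
  apply: cid; have [/v_div //|ge3] := ltnP (kind i) 3.
  by exists (P v i); rewrite /p; case: (kind i) ge3 => [|[|[|k]]] //; rewrite mulr1.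
exists (W [ffun i => sval (div i)]); rewrite d4W {2}def_v; congr (Z _).
by apply/ffunP => i; rewrite !ffunE mulrC -(svalP (div i)).
Qed.

(** Used to lift an element of sum_mod to a chain. *)
Let spread k (y : 'I_#|K k| -> kring) : A :=
  [ffun i => if [pick j | nth_of_kind k j == i] is Some j then y j else 0].

Let spread_index k y j : spread y (nth_of_kind k j) = y j.
Proof.
by rewrite ffunE; case: pickP => [j' /eqP/enum_val_inj->|/(_ j)/eqP].
Qed.

Let spread_out k (y : 'I_#|K k| -> kring) i : kind i != k -> spread y i = 0.
Proof.
by rewrite ffunE; case: pickP => // j /eqP <-; rewrite kind_index eqxx.
Qed.

Let coords_onto x : exists2 v, d3 v = 0 & coords v = x.
Proof.
case: x => [[x0 x1] x2].
pose y1 j := sval (cid (residue_onto (x1 j))).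
pose y2 j := sval (cid (residue_onto (x2 j))).
pose c := spread x0 + spread y1 + spread y2.
have cE i : c i = spread x0 i + spread y1 i + spread y2 i by rewrite !ffunE.
exists (Z c) => //; congr (_, _, _); apply/ffunP => j;
  rewrite ffunE PZ ?kind_index // cE.
- by rewrite spread_index !spread_out ?kind_index // !addr0.
- rewrite spread_index !spread_out ?kind_index // add0r addr0.
  by rewrite /y1; case: cid.
- rewrite spread_index !spread_out ?kind_index // add0r add0r.
  by rewrite /y2; case: cid.
Qed.

Lemma diagonal_homology :
  lmod_iso (homology d4 d3) (sum_mod #|K 0| #|K 1| #|K 2|).
Proof.
pose F : {linear V3 -> sum_mod #|K 0| #|K 1| #|K 2|} :=
  HB.pack coords (GRing.isLinear.Build _ _ _ _ coords coords_linear).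
by apply: (homology_iso (F := F)); [exact: coords_boundary|exact: coords_onto].
Qed.
End DiagonalHomology.

(** * Diagonalising the differential of degree four *)

(** The four cases are: free generators, generators of order 1 - x^2, words that
    complete the cycles to a basis of all chains, generators of order 1 - x. *)
Definition kind (w : word) : nat :=
  let u := std w in
  if u \in [:: [:: 0; 0; 0]; [:: 1; 0; 0]; [:: 2; 1; 0]; [:: 3; 2; 1]]%N then 0
  else if u \in [:: [:: 1; 1; 0]; [:: 1; 1; 1]; [:: 2; 1; 1]; [:: 2; 2; 1]]%N then 2
  else if u \in [:: [:: 0; 0; 1]; [:: 0; 1; 1]; [:: 0; 2; 1]]%N then 3
  else 1.

Definition divisor (k : nat) : coef := nth [:: 1] [:: [::]; [:: 1; -1]; [:: 1; 0; -1]] k.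

Definition diagonal (p : nat -> coef) (w : word) : comb := [:: (p (kind w), w)].

(** The projection onto the words that index the basis of cycles. *)
Definition cyclic_part : word -> comb := diagonal (fun k => if (k < 3)%N then [:: 1] else [::]).

(** The Dold-Kan projector (1 - e_j) ... (1 - e_1) applied to a pattern with
    positive letters 1, ..., j, where e_i lowers the letter i to i - 1. *)
Definition normalize (w : word) : comb :=
  foldl (fun l i => sub l (rmap (fun a => if a == i then a.-1 else a) l))
    (unit_comb w) (letters w).

(** The inverse of F by the iteration l := w + l - F l, that is, the Neumann
    series of 1 - F cut off after the power k. All F below are unitriangular for
    a suitable order of the words, and k is large enough for (1 - F)^(k + 1) to
    vanish. *)
Definition invert (k : nat) (F : word -> comb) (w : word) : comb :=
  iter k (fun l => collect (unit_comb w ++ sub l (bind l F))) (unit_comb w).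

(** The three tables refer to the basis of normalised words, in which only words
    with all the letters of the pattern occur. Rows of cycle_rows are the cycles
    that result from the operations among words of length 3; a normalised word
    whose pattern has kind < 3 and no row is a cycle itself. *)
Definition cycle_rows : table := [::
  ([:: 0; 1; 0],
    [:: term [:: 1] [:: 0; 1; 0];
        term [:: 0; 1] [:: 1; 0; 0]]);
  ([:: 1; 0; 1],
    [:: term [:: 1] [:: 1; 0; 1];
        term [:: -1; -1] [:: 1; 0; 0];
        term [:: 0; 1] [:: 1; 1; 0]]);
  ([:: 1; 1; 1],
    [:: term [:: 1] [:: 1; 1; 1];
        term [:: -1] [:: 1; 0; 0]]);
  ([:: 0; 1; 2],
    [:: term [:: 1] [:: 0; 1; 2];
        term [:: -1] [:: 0; 2; 1];
        term [:: 0; -1; -1] [:: 2; 0; 1]]);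
  ([:: 1; 0; 2],
    [:: term [:: 1] [:: 1; 0; 2];
        term [:: 0; 1] [:: 1; 2; 0]]);
  ([:: 1; 1; 2],
    [:: term [:: 1] [:: 1; 1; 2];
        term [:: -1] [:: 0; 2; 1];
        term [:: 0; 1] [:: 1; 2; 1];
        term [:: 0; -1] [:: 2; 0; 1]]);
  ([:: 1; 2; 0],
    [:: term [:: 1] [:: 1; 2; 0];
        term [:: 0; 1] [:: 2; 1; 0]]);
  ([:: 1; 2; 1],
    [:: term [:: 1] [:: 1; 2; 1];
        term [:: 0; 1] [:: 2; 1; 1]]);
  ([:: 1; 2; 2],
    [:: term [:: 1] [:: 1; 2; 2];
        term [:: 1] [:: 0; 2; 1];
        term [:: 0; 1] [:: 2; 0; 1];
        term [:: -1; -1; -1] [:: 2; 2; 1]]);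
  ([:: 2; 0; 1],
    [:: term [:: 1] [:: 2; 0; 1];
        term [:: 0; 1] [:: 2; 1; 0]]);
  ([:: 2; 1; 2],
    [:: term [:: 1] [:: 2; 1; 2];
        term [:: 0; 1] [:: 2; 2; 1]]);
  ([:: 1; 2; 3],
    [:: term [:: 1] [:: 1; 2; 3];
        term [:: 0; 0; -1] [:: 3; 1; 2]]);
  ([:: 1; 3; 2],
    [:: term [:: 1] [:: 1; 3; 2];
        term [:: 0; 1] [:: 3; 1; 2]]);
  ([:: 2; 1; 3],
    [:: term [:: 1] [:: 2; 1; 3];
        term [:: 0; 1] [:: 2; 3; 1]]);
  ([:: 2; 3; 1],
    [:: term [:: 1] [:: 2; 3; 1];
        term [:: 0; 1] [:: 3; 2; 1]]);
  ([:: 3; 1; 2],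
    [:: term [:: 1] [:: 3; 1; 2];
        term [:: 0; 1] [:: 3; 2; 1]])].

(** Chains of degree 4 whose boundary is p(w) times the cycle of w; they record
    the operations among words of length 4. *)
Definition lift_rows : table := [::
  ([:: 0; 1; 0],
    [:: term [:: -1] [:: 0; 0; 1; 0]]);
  ([:: 1; 0; 1],
    [:: term [:: 1] [:: 1; 0; 0; 1]]);
  ([:: 1; 1; 0],
    [:: term [:: -1] [:: 0; 0; 1; 0];
        term [:: -1] [:: 0; 1; 1; 0]]);
  ([:: 1; 1; 1],
    [:: term [:: 1] [:: 1; 0; 0; 1];
        term [:: 1] [:: 1; 0; 1; 1]]);
  ([:: 0; 1; 2],
    [:: term [:: 1] [:: 1; 0; 0; 2];
        term [:: -1] [:: 1; 0; 1; 2];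
        term [:: 1] [:: 1; 0; 2; 1]]);
  ([:: 1; 0; 2],
    [:: term [:: 1] [:: 1; 0; 0; 2]]);
  ([:: 1; 1; 2],
    [:: term [:: 1] [:: 1; 0; 0; 2];
        term [:: 1] [:: 1; 0; 2; 1]]);
  ([:: 1; 2; 0],
    [:: term [:: -1] [:: 1; 1; 2; 0]]);
  ([:: 1; 2; 1],
    [:: term [:: -1] [:: 1; 1; 2; 1]]);
  ([:: 1; 2; 2],
    [:: term [:: 1] [:: 0; 2; 2; 1]]);
  ([:: 2; 0; 1],
    [:: term [:: -1] [:: 2; 1; 0; 2]]);
  ([:: 2; 1; 1],
    [:: term [:: -1] [:: 2; 1; 1; 2];
        term [:: -1] [:: 2; 1; 2; 2]]);
  ([:: 2; 1; 2],
    [:: term [:: -1] [:: 2; 1; 2; 2]]);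
  ([:: 2; 2; 1],
    [:: term [:: -1] [:: 1; 1; 2; 1];
        term [:: -1] [:: 1; 2; 2; 1]]);
  ([:: 1; 2; 3],
    [:: term [:: -1] [:: 2; 1; 2; 3]]);
  ([:: 1; 3; 2],
    [:: term [:: 1] [:: 1; 3; 3; 2]]);
  ([:: 2; 1; 3],
    [:: term [:: 1] [:: 2; 1; 1; 3]]);
  ([:: 2; 3; 1],
    [:: term [:: -1] [:: 1; 2; 3; 1]]);
  ([:: 3; 1; 2],
    [:: term [:: 1] [:: 3; 1; 1; 2]])].

(** On the span of the patterns of kind 3 the differential is injective but its
    image is not a direct summand: the elementary divisors are 1 - x, twice, and
    1 - x^2. The rows give its left inverse up to the factor 1 - x^2. *)
Definition splitting_rows : table := [::
  ([:: 0; 1],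
    [:: term [:: -1; -1] [:: 0; 0; 1]]);
  ([:: 1; 1],
    [:: term [:: -1] [:: 0; 0; 1];
        term [:: -1] [:: 0; 1; 1]]);
  ([:: 1; 2],
    [:: term [:: -1; -1] [:: 0; 2; 1]])].

Definition normal_table n := tabulate n normalize.

Definition lookup_or_unit (t : table) (w : word) :=
  if has (fun r => r.1 == w) t then lookup t w else unit_comb w.

(** The basis of 3-chains that consists of the cycles and, for the patterns of
    kind 3, of the normalised words, written out in words. *)
Definition basis_table : table := Eval vm_compute in
  let N := extend (normal_table 3) in
  tabulate 3 (fun w => bind (lookup_or_unit cycle_rows w) N).

Definition cycle_table : table := Eval vm_compute in
  tabulate 3 (fun w => bind (cyclic_part w) (extend basis_table)).

(** The coordinates with respect to that basis, restricted to the cycles. *)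
Definition coord_table : table := Eval vm_compute in
  tabulate 3 (fun w => bind (invert 6 (extend basis_table) w) cyclic_part).

Definition lift_table : table := Eval vm_compute in
  let N := extend (normal_table 4) in
  tabulate 3 (fun w => bind (lookup lift_rows w) N).

Definition splitting_table : table := Eval vm_compute in
  let N3 := extend (normal_table 3) in
  let N2 := extend (normal_table 2) in
  tabulate 2 (fun w => bind (bind (invert 2 N2 w) (extend splitting_rows)) N3).

(** Division by 1 - x^2 = (1 - x) (1 + x) is done in two steps. *)
Definition divide (w : word) (p : coef) : coef :=
  if kind w == 2 then cdiv (-1) 0 (cdiv 1 0 p) else cdiv 1 0 p.

(** P d4 divided by the elementary divisors; the last clause of the certificate
    tests that the division is exact. *)
Definition quotient_table : table := Eval vm_compute in
  let P := extend coord_table in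
  tabulate 4 (fun w => [seq (divide a.2 a.1, a.2) | a <- collect (bind (diff_word w) P)]).

(** The five identities on patterns; for natural maps they then hold on all
    words. *)
Definition certificate (Z P W h g : word -> comb) : bool :=
  [&& all (fun w => vanish (bind (Z w) diff_word)) (patterns 3),
      all (fun w => vanish (sub (bind (Z w) P) (cyclic_part w))) (patterns 3),
      all (fun w => vanish (sub (scale (divisor 2) (sub (unit_comb w) (bind (P w) Z)))
                          (bind (diff_word w) h))) (patterns 3),
      all (fun w => vanish (sub (bind (W w) diff_word) (bind (diagonal divisor w) Z)))
        (patterns 3) &
      all (fun w => vanish (sub (bind (diff_word w) P) (bind (g w) (diagonal divisor))))
        (patterns 4)].

Lemma certified : certificate (extend cycle_table) (extend coord_table)
  (extend lift_table) (extend splitting_table) (extend quotient_table).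
Proof. by vm_compute. Qed.

Section ThirdHomology.
Variables (m : nat) (m_gt0 : (0 < m)%N).

Lemma natural_diagonal p : natural (diagonal p).
Proof. by move=> f w f_emb; rewrite /diagonal /kind std_map. Qed.

Lemma diagonal_local p n : local_map n n (diagonal p).
Proof.
split=> [|w size_w]; first exact: natural_diagonal.
rewrite /fits /= size_w eqxx andbT; apply/allP => i w_i /=.
by rewrite inE mem_letters w_i andbT; case: (i).
Qed.

Lemma act_diagonal p n (c : chain m n) (t : n.-tuple 'I_m) :
  act n (diagonal p) c t = ceval (p (kind (map val t))) * c t.
Proof.
rewrite /act /linext sum_ffunE (bigD1 t) //= big1 ?addr0 => [|s ne_st].
  by rewrite /total big_seq1 /= !ffunE eqxx [_ *: 1]mulr1 mulrC.
rewrite /total big_seq1 /= wvec_tuple !ffunE eq_sym (negbTE ne_st).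
by rewrite [_ *: 0]mulr0 [_ *: 0]mulr0.
Qed.

Lemma ceval_divisor k : ceval (divisor k) = elementary_divisor k.
Proof.
case: k => [|[|[|k]]] //=; first exact: ceval_1BX.
  rewrite !ceval_cons ceval_nil mul0r add0r polyC0 addr0 polyCN mulN1r mulNr addrC.
  by rewrite -expr2.
by rewrite /divisor nth_default // ceval_cons ceval_nil mul0r add0r.
Qed.

(** Chains are torsion-free, as Z[x] is a domain and 1 - x^2 has constant term 1. *)
Lemma scale_divisor2_regular n (v : chain m n) : ceval (divisor 2) *: v = 0 -> v = 0.
Proof.
move=> qv0; apply/ffunP => t; rewrite ffunE.
have /eqP := congr1 (fun f : {ffun _ -> _} => f t) qv0.
rewrite !ffunE => /eqP qvt0.
have := mulf_eq0 (ceval (divisor 2) : {poly int}) (v t : {poly int}).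
rewrite [_ * _]qvt0 eqxx => /esym/orP[|/eqP //].
by move/eqP/(congr1 (fun p : {poly int} => p`_0)); rewrite coef_Poly coef0.
Qed.

Let tuple_pattern n (t : n.-tuple 'I_m) : std (map val t) \in patterns n.
Proof. by have := std_pattern (map val t); rewrite size_map size_tuple. Qed.

Lemma third_homology_by_kind :
  let K k := [pred t : 3.-tuple 'I_m | kind (map val t) == k] in
  lmod_iso (YB_homology m 3) (sum_mod #|K 0| #|K 1| #|K 2|).
Proof.
have Z_loc : local_map 3 3 (extend cycle_table) by apply: extend_local; vm_compute.
have P_loc : local_map 3 3 (extend coord_table) by apply: extend_local; vm_compute.
have W_loc : local_map 3 4 (extend lift_table) by apply: extend_local; vm_compute.
have h_loc : local_map 2 3 (extend splitting_table) by apply: extend_local; vm_compute.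
have g_loc : local_map 4 3 (extend quotient_table) by apply: extend_local; vm_compute.
have := certified; move: (extend cycle_table) (extend coord_table)
  (extend lift_table) (extend splitting_table) (extend quotient_table)
  Z_loc P_loc W_loc h_loc g_loc => Z P W h g Z_loc P_loc W_loc h_loc g_loc.
case/and5P => /allP cert1 /allP cert2 /allP cert3 /allP cert4 /allP cert5.
apply: (diagonal_homology (kind := fun t : 3.-tuple 'I_m => kind (map val t))
  (Z := act 3 Z) (P := act 3 P) (W := act 4 W) (g := act 3 g) (h := act 3 h)
  (q := ceval (divisor 2))).
- move=> c; change (diff (act 3 Z c) = 0); rewrite diff_act.
  apply: (linear_eq0 (F := act 2 diff_word \o act 3 Z)) => t /=.
  rewrite (act_comp_basis _ _ _ Z_loc natural_diff_word) //.
  exact/push_vanish/cert1/tuple_pattern.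
- move=> c t lt_k.
  have /eqP : ((act 3 P \o act 3 Z) \- act 3 cyclic_part) c = 0.
    apply: linear_eq0 c => s /=.
    rewrite (act_comp_basis _ _ _ Z_loc (proj1 P_loc)) //.
    rewrite (act_basis _ _ (natural_diagonal _)) -total_sub.
    exact/push_vanish/cert2/tuple_pattern.
  rewrite subr_eq0 => /eqP /= ->; rewrite act_diagonal lt_k.
  by rewrite ceval_cons ceval_nil mul0r add0r mul1r.
- move=> v; change (ceval (divisor 2) *: (v - act 3 Z (act 3 P v)) = act 3 h (diff v)).
  rewrite diff_act; apply/eqP; rewrite -subr_eq0; apply/eqP.
  pose q := ceval (divisor 2).
  apply: (linear_eq0 (F := (q \*: (idfun \- (act 3 Z \o act 3 P)))
    \- (act 3 h \o act 2 diff_word))) => t /=.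
  rewrite (act_comp_basis _ _ _ P_loc (proj1 Z_loc)) //.
  rewrite (act_comp_basis _ _ _ diff_word3_local (proj1 h_loc)) //.
  rewrite -[basis kring t]push_unit /q -total_sub -total_scale -total_sub.
  exact/push_vanish/cert3/tuple_pattern.
- exact: scale_divisor2_regular.
- move=> c; rewrite -[LHS]/(diff (act 4 W c)) diff_act.
  have -> : [ffun t : 3.-tuple 'I_m => elementary_divisor (kind (map val t)) * c t] =
      act 3 (diagonal divisor) c.
    by apply/ffunP => t; rewrite ffunE act_diagonal ceval_divisor.
  apply/eqP; rewrite -subr_eq0; apply/eqP.
  apply: (linear_eq0 (F := (act 3 diff_word \o act 4 W)
    \- (act 3 Z \o act 3 (diagonal divisor)))) => t /=.
  rewrite (act_comp_basis _ _ _ W_loc natural_diff_word) //.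
  rewrite (act_comp_basis _ _ _ (diagonal_local _ _) (proj1 Z_loc)) // -total_sub.
  exact/push_vanish/cert4/tuple_pattern.
move=> u t; change (act 3 P (diff u) t = elementary_divisor (kind (map val t)) * act 3 g u t).
rewrite diff_act -ceval_divisor -(act_diagonal divisor).
have /eqP : ((act 3 P \o act 3 diff_word) \- (act 3 (diagonal divisor) \o act 3 g)) u = 0.
  apply: linear_eq0 u => s /=.
  rewrite (act_comp_basis _ _ _ diff_word4_local (proj1 P_loc)) //.
  rewrite (act_comp_basis _ _ _ g_loc (natural_diagonal _)) // -total_sub.
  exact/push_vanish/cert5/tuple_pattern.
by rewrite subr_eq0 => /eqP /= ->.
Qed.
End ThirdHomology.

(** * Counting words of a given pattern *)

(** In a pattern every positive letter is its own rank among the letters. *)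
Lemma letters_pattern u : std u = u -> letters u = iota 1 (size (letters u)).
Proof.
move=> std_u; apply: (@eq_from_nth _ 0%N) => [|i lt_i]; first by rewrite size_iota.
rewrite nth_iota // add1n.
have L_uniq : uniq (0%N :: letters u).
  by have := letters_sorted u; rewrite ltn_sorted_uniq_leq => /andP[].
have u_i : nth 0%N (letters u) i \in u.
  by have := mem_nth 0%N lt_i; rewrite mem_letters => /andP[].
have /eq_in_map/(_ _ u_i) : map (fun a => index a (0%N :: letters u)) u = map id u.
  by rewrite map_id.
rewrite -[X in index X _]/(nth 0%N (0%N :: letters u) i.+1).
by rewrite index_uniq // => ->.
Qed.

Section Counting.
Variable m : nat.

(** A word of pattern u is the choice of its positive letters, an increasing
    sequence; entries s of 'I_m stand for the letters s + 1. *)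
Lemma card_std n (u : word) : u \in patterns n ->
  #|[pred t : n.-tuple 'I_m.+1 | std (map val t) == u]| = 'C(m, size (letters u)).
Proof.
rewrite mem_filter mem_all_words => /andP[/eqP std_u /andP[/eqP size_u _]].
set j := size (letters u).
pose shift (s : j.-tuple 'I_m) := map (fun i : 'I_m => i.+1) s.
have shift_sorted (s : j.-tuple 'I_m) :
    sorted ltn (map val s) -> sorted ltn (0%N :: shift s).
  move=> s_sorted; rewrite /= path_sortedE; last exact: ltn_trans.
  rewrite all_map all_predT /=.
  by rewrite /shift (map_comp succn val) sorted_map; apply: sub_sorted s_sorted.
pose relabelled (s : j.-tuple 'I_m) := map (relabel (shift s)) u.
have rel_valid s : valid m.+1 n (relabelled s).
  rewrite /valid size_map size_u eqxx all_map; apply/allP => i u_i /=.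
  have le_i : (i <= j)%N by rewrite -std_u in u_i; apply: (allP (std_bound u)).
  rewrite /relabel; have: nth (last 0 (shift s) + i)%N (0%N :: shift s) i \in 0%N :: shift s.
    by rewrite mem_nth // /= size_map size_tuple.
  by rewrite inE => /predU1P[->//|/mapP[k _ ->]]; rewrite ltnS ltn_ord.
have rel_tuple s : {t : n.-tuple 'I_m.+1 | map val t = relabelled s}.
  by apply: cid; have /validP[t ->] := rel_valid s; exists t.
pose F s := sval (rel_tuple s).
have FE s : map val (F s) = relabelled s := svalP (rel_tuple s).
have lettersF (s : j.-tuple 'I_m) : sorted ltn (map val s) ->
    letters (map val (F s)) = shift s.
  move=> /shift_sorted/relabel_embedding emb; rewrite FE letters_map //.
  rewrite (letters_pattern std_u) -/j; apply: (@eq_from_nth _ 0%N) => [|i].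
    by rewrite !size_map size_iota size_tuple.
  rewrite size_map size_iota => lt_ij.
  rewrite (nth_map 0%N) ?size_iota // nth_iota // add1n /relabel /=.
  by apply: set_nth_default; rewrite size_map size_tuple.
pose S := [set s : j.-tuple 'I_m | sorted ltn (map val s)].
have F_inj : {in S &, injective F}.
  move=> s1 s2; rewrite !inE => s1_sorted s2_sorted eqF.
  have := lettersF _ s1_sorted; rewrite eqF lettersF // => eq_shift.
  by apply/val_inj/esym/(inj_map _ eq_shift) => i k [] /val_inj.
rewrite -(card_ltn_sorted_tuples j m) -(card_in_imset F_inj) -[LHS]cardsE.
apply: eq_card => t; rewrite inE; apply/eqP/imsetP => [std_t|[s + ->]]; last first.
  by rewrite inE FE => /shift_sorted/relabel_embedding/std_map->.
set L := letters (map val t).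
have size_L : size L = j by rewrite /L -size_letters_std std_t.
have L_gt0 i : i \in L -> (0 < i)%N by rewrite mem_letters => /andP[].
have L_pred : map succn (map predn L) = L.
  by rewrite -map_comp map_id_in // => i /L_gt0; apply: prednK.
have /validP[s def_s] : valid m j (map predn L).
  rewrite /valid size_map size_L eqxx all_map; apply/allP => i L_i /=.
  have := L_i; rewrite mem_letters => /andP[i_gt0 /mapP[k _ def_i]].
  by rewrite -ltnS prednK // def_i ltn_ord.
have shift_s : shift s = L by rewrite /shift (map_comp succn val) -def_s.
exists s.
  rewrite inE -def_s sorted_map.
  have := letters_sorted (map val t); rewrite /= -/L => /path_sorted.
  apply: (@sub_in_sorted _ [pred i | (0 < i)%N]); last exact/allP.
  by move=> [|i] [|k].
apply/val_inj/(inj_map val_inj).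
by rewrite [RHS]FE /relabelled shift_s -std_t relabel_std.
Qed.

Lemma card_kind k :
  #|[pred t : 3.-tuple 'I_m.+1 | kind (map val t) == k]| =
  (\sum_(j <- [seq size (letters u) | u <- patterns 3 & kind u == k]) 'C(m, j))%N.
Proof.
rewrite big_map big_filter.
transitivity (\sum_(u <- patterns 3 | kind u == k)
   #|[pred t : 3.-tuple 'I_m.+1 | std (map val t) == u]|)%N; last first.
  by rewrite big_seq_cond [RHS]big_seq_cond; apply: eq_bigr => u /andP[/card_std].
rewrite -sum1_card; under [RHS]eq_bigr do rewrite -sum1_card.
rewrite (exchange_big_dep (fun t : 3.-tuple 'I_m.+1 => kind (map val t) == k)) /=.
  apply: eq_bigr => t kind_t; rewrite sum1_count.
  rewrite (eq_count (a2 := pred1 (std (map val t)))) => [|u]; last first.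
    rewrite /= inE [RHS]eq_sym andbC; case: (std (map val t) =P u) => //= <-.
    by rewrite /kind std_idem.
  rewrite count_uniq_mem //; have := std_pattern (map val t).
  by rewrite size_map size_tuple => ->.
by move=> u t kind_u /eqP def_u; rewrite -def_u /kind std_idem in kind_u.
Qed.

Lemma count_free : #|[pred t : 3.-tuple 'I_m.+1 | kind (map val t) == 0%N]| =
  ('C(m, 0) + 'C(m, 1) + 'C(m, 2) + 'C(m, 3))%N.
Proof.
rewrite card_kind; set s := map _ _; have -> : s = [:: 0; 1; 2; 3]%N by vm_compute.
by rewrite !big_cons big_nil; lia.
Qed.

Lemma count_linear : #|[pred t : 3.-tuple 'I_m.+1 | kind (map val t) == 1%N]| =
  (2 * 'C(m, 1) + 8 * 'C(m, 2) + 5 * 'C(m, 3))%N.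
Proof.
rewrite card_kind (perm_big (nseq 2 1 ++ nseq 8 2 ++ nseq 5 3)%N) /=; last by vm_compute.
by rewrite !big_cons big_nil; lia.
Qed.

Lemma count_square : #|[pred t : 3.-tuple 'I_m.+1 | kind (map val t) == 2%N]| =
  (2 * 'C(m, 1) + 2 * 'C(m, 2))%N.
Proof.
rewrite card_kind (perm_big (nseq 2 1 ++ nseq 2 2)%N) /=; last by vm_compute.
by rewrite !big_cons big_nil; lia.
Qed.
End Counting.

Lemma bin2_rat n : 'C(n, 2)%:R = n%:R * (n%:R - 1) / 2 :> rat.
Proof.
elim: n => [|n IH]; first by rewrite !mul0r.
by rewrite binS natrD IH bin1 -natr1; field.
Qed.

Lemma bin3_rat n : 'C(n, 3)%:R = n%:R * (n%:R - 1) * (n%:R - 2) / 6 :> rat.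
Proof.
elim: n => [|n IH]; first by rewrite !mul0r.
by rewrite binS natrD IH bin2_rat -natr1; field.
Qed.

Theorem theorem4p3 (m : nat) (hm : (1 <= m)%N) :
  let a := ('C(m.-1, 0) + 'C(m.-1, 1) + 'C(m.-1, 2) + 'C(m.-1, 3))%N in
  let b := (2 * 'C(m.-1, 1) + 8 * 'C(m.-1, 2) + 5 * 'C(m.-1, 3))%N in
  let c := (2 * 'C(m.-1, 1) + 2 * 'C(m.-1, 2))%N in
  lmod_iso (YB_homology m 3) (sum_mod a b c) /\
  [/\ a%:R = m%:R * (8 - 3 * m%:R + m%:R ^+ 2) / 6 :> rat,
      b%:R = (m%:R ^+ 2 - 1) * (5 * m%:R - 6) / 6 :> rat &
      c%:R = m%:R * (m%:R - 1) :> rat].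
Proof.
case: m hm => // n _ a b c; split.
  rewrite /a /b /c -count_free -count_linear -count_square.
  exact: third_homology_by_kind.
by split; rewrite /a /b /c /= !natrD ?natrM ?bin0 bin1 bin2_rat ?bin3_rat -natr1; field.
Qed.
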